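(* The complete graph $K_7$ is $M'$-contractible, but not contractible.
   Context: All graphs are finite and simple (no loops or multiple edges). Let $G$ and $H$ be graphs with $V(H)\subseteq V(G)$. An $H$-scheme in $G$ is a collection of paths $\{P_{uv}: uv\in E(H)\}$ such that (1) each $P_{uv}$ is a $u,v$-path in $G$ with $V(P_{uv})\cap V(H)=\{u,v\}$, and (2) whenever $e_1,\dots,e_k\in E(H)$ satisfy $V(P_{e_1})\cap\dots\cap V(P_{e_k})\neq\emptyset$, there is a vertex $u\in V(H)$ incident with each of $e_1,\dots,e_k$. $G$ has a rooted $H$-minor if there are pairwise vertex-disjoint connected subgraphs $C_v$ of $G$, one for each $v\in V(H)$, such that $v\in V(C_v)$ for all $v\in V(H)$ and for each edge $uv\in E(H)$ there is an edge of $G$ joining $C_u$ and $C_v$. A graph $H$ is contractible if every graph $G$ with $V(H)\subseteq V(G)$ that contains an $H$-scheme has a rooted $H$-minor. For a graph $H$, $M'(H)$ is the graph that contains two vertices $v_1,v_2$ for every $v\in V(H)$, and in which $u_i$ is adjacent to $v_j$ exactly when $uv\in E(H)$ and ($i=2$ or $j=2$ or both). $H$ is $M'$-contractible if $M'(H)$ contains a rooted $H$-minor where $v_1$ is the root corresponding to $v\in V(H)$; that is, there are pairwise vertex-disjoint connected subgraphs $C_v$ of $M'(H)$, one for each $v\in V(H)$, such that $v_1\in V(C_v)$ for all $v\in V(H)$ and for each edge $uv\in E(H)$ there is an edge of $M'(H)$ joining $C_u$ and $C_v$. *)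

(* Defs.v *)
From mathcomp Require Import all_boot.

Set Implicit Arguments.
Unset Strict Implicit.
Unset Printing Implicit Defensive.

Record sgraph := SGraph {
  vertex :> finType;
  edge : rel vertex;
  edge_sym : symmetric edge;
  edge_irrefl : irreflexive edge
}.

Definition edges (G : sgraph) : {set {set G}} :=
  [set [set x.1; x.2] | x : G * G & edge x.1 x.2].

Lemma complete_sym n : symmetric (fun x y : 'I_n => x != y).
Proof. by move=> x y; rewrite eq_sym. Qed.

Lemma complete_irrefl n : irreflexive (fun x y : 'I_n => x != y).
Proof. by move=> x; rewrite eqxx. Qed.

Definition complete (n : nat) : sgraph :=
  SGraph (@complete_sym n) (@complete_irrefl n).

(* [s] lists the vertices of an x,y-path of [G] in order, both ends included. *)
Definition is_path (G : sgraph) (x y : G) (s : seq G) : Prop :=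
  exists q : seq G,
    [/\ s = x :: q, path (@edge G) x q, last x q = y & uniq s].

Record subgraph (G : sgraph) := Subgraph {
  sub_vertex : {set G};
  sub_edge : rel G;
  sub_edge_sym : symmetric sub_edge;
  sub_edge_edge : forall x y, sub_edge x y -> edge x y;
  sub_edge_vertex : forall x y, sub_edge x y -> x \in sub_vertex
}.

Definition connected (G : sgraph) (C : subgraph G) : Prop :=
  sub_vertex C != set0 /\
  {in sub_vertex C &, forall x y, connect (sub_edge C) x y}.

(* The inclusion of V(H) in V(G) is represented by a map [r : H -> G], which  *)
(* is required to be injective in [contractible] (and is so for M').          *)

(* [P] is indexed by the undirected edges of [H]; its values outside          *)
(* [edges H] are irrelevant. An edge {u,v} gets a single path, which may be   *)
(* listed from either end.                                                    *)
Definition is_scheme (H G : sgraph) (r : H -> G) (P : {set H} -> seq G) :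
    Prop :=
  (forall e, e \in edges H -> exists u v : H,
     [/\ e = [set u; v], is_path (r u) (r v) (P e)
       & [set x in P e] :&: [set r w | w : H] = [set r u; r v]]) /\
  (forall F : {set {set H}}, F != set0 -> F \subset edges H ->
     (exists x : G, forall e, e \in F -> x \in P e) ->
     exists u : H, forall e, e \in F -> u \in e).

Definition rooted_minor (H G : sgraph) (r : H -> G) : Prop :=
  exists C : H -> subgraph G,
    [/\ forall v, connected (C v),
        forall u v, u != v -> [disjoint sub_vertex (C u) & sub_vertex (C v)],
        forall v, r v \in sub_vertex (C v)
      & forall u v, edge u v -> exists x y : G,
          [/\ x \in sub_vertex (C u), y \in sub_vertex (C v) & edge x y]].

Definition contractible (H : sgraph) : Prop :=
  forall (G : sgraph) (r : H -> G), injective r ->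
    (exists P : {set H} -> seq G, is_scheme r P) -> rooted_minor r.

(* [(v, false)] stands for v_1 and [(v, true)] for v_2. *)
Definition Mprime_edge (H : sgraph) : rel (H * bool) :=
  fun x y => edge x.1 y.1 && (x.2 || y.2).

Lemma Mprime_sym (H : sgraph) : symmetric (@Mprime_edge H).
Proof. by move=> x y; rewrite /Mprime_edge edge_sym orbC. Qed.

Lemma Mprime_irrefl (H : sgraph) : irreflexive (@Mprime_edge H).
Proof. by move=> x; rewrite /Mprime_edge edge_irrefl. Qed.

Definition Mprime (H : sgraph) : sgraph :=
  SGraph (@Mprime_sym H) (@Mprime_irrefl H).

Definition Mprime_contractible (H : sgraph) : Prop :=
  @rooted_minor H (Mprime H) (fun v => (v, false)).

(* Main.v *)
(* For a graph H, the paths u_1 v_2 u_2 v_1 form an H-scheme in M'(H).        *)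
(* Joining u_1 and v_1 for all distinct nonadjacent u, v completes it to a    *)
(* K_n-scheme, and these new edges can only make the bags of u and v          *)
(* adjacent. So if K_n were contractible, every graph H on n vertices would   *)
(* be M'-contractible. This fails for H = C_7 with a chord that closes a      *)
(* 4-cycle. Indeed, let W_v be the set of all w with w_2 in the bag of v. As  *)
(* H is triangle-free, if W_v is empty, then |W_u| >= 2 for all neighbours u  *)
(* of v; since |S| < |N(S)| for all nonempty independent sets S, counting     *)
(* shows that no W_v is empty. Then W_v = {s v} for an injective endomorphism *)
(* s of H such that v and s v are adjacent for all v. This s must swap the    *)
(* ends of the chord, which are the only vertices of degree 3, and then the   *)
(* neighbour of one end on the 5-cycle has no image left.                     *)
From mathcomp Require Import all_boot zify.
Require Import Defs.

Set Implicit Arguments.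
Unset Strict Implicit.
Unset Printing Implicit Defensive.

(** The positive half shifts the second copies cyclically: the bags {v_1, (v+1)_2} of M'(K_n) are
    pairwise adjacent through their second-copy vertices. The negative half rests on
    [bag_endomorphism]: for a triangle-free H whose nonempty independent sets expand, a rooted
    H-minor of [root_completion H] yields an injective endomorphism moving each vertex to a
    neighbour. [chorded_cycle_endomorphism] excludes this for a graph on 7 vertices. *)

Section Induced.
Variables (G : sgraph) (A : {set G}).

Definition induced_edge : rel G :=
  fun x y => [&& x \in A, y \in A & edge x y].

Lemma induced_edge_sym : symmetric induced_edge.
Proof. by move=> x y; rewrite /induced_edge edge_sym andbCA. Qed.

Lemma induced_edge_edge x y : induced_edge x y -> edge x y.
Proof. by case/and3P. Qed.

Lemma induced_edge_vertex x y : induced_edge x y -> x \in A.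
Proof. by case/and3P. Qed.

Definition induced : subgraph G :=
  Subgraph induced_edge_sym induced_edge_edge induced_edge_vertex.

End Induced.

Lemma connected_induced2 (G : sgraph) (x y : G) :
  edge x y -> connected (induced [set x; y]).
Proof.
move=> xy; split; first by apply/set0Pn; exists x; rewrite /= set21.
move=> u v /=; rewrite !inE => /orP[] /eqP-> /orP[] /eqP->;
  rewrite ?connect0 //; apply: connect1;
  by rewrite /= /induced_edge !inE !eqxx ?orbT //= edge_sym.
Qed.

Lemma Mprime_contractible_complete n :
  1 < n -> Mprime_contractible (complete n).
Proof.
move=> n_gt1.
have ordS_neq (v : 'I_n) : v != ordS v.
  apply/eqP => /(congr1 val) /=; case: v => v /= lt_vn.
  by case: (ltnP v.+1 n) => [lt|ge];
    [rewrite modn_small | have ->: v.+1 = n by lia]; rewrite ?modnn; lia.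
pose G := Mprime (complete n).
exists (fun v : 'I_n => induced [set ((v, false) : G); (ordS v, true)]); split.
- by move=> v; apply: connected_induced2; rewrite /= /Mprime_edge /= ordS_neq.
- move=> u v ne_uv; apply/pred0P => -[w b] /=; rewrite !inE !xpair_eqE.
  apply/negP; case: b; rewrite ?andbT ?andbF ?orbF /= => /andP[/eqP-> /eqP].
    by move/(can_inj (@ordSK n))/eqP; apply/negP.
  by apply/eqP.
- by move=> v /=; rewrite set21.
- move=> u v /= ne_uv; exists (ordS u, true), (ordS v, true).
  split; rewrite ?set22 // /Mprime_edge /= andbT.
  by rewrite (inj_eq (can_inj (@ordSK n))).
Qed.

(** * From rooted minors of the completed M'(H) to endomorphisms of H *)

Section RootCompletion.
Variable H : sgraph.

Definition root_completion_edge : rel (H * bool) := fun x y =>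
  if x.2 || y.2 then edge x.1 y.1 else (x.1 != y.1) && ~~ edge x.1 y.1.

Lemma root_completion_sym : symmetric root_completion_edge.
Proof.
by move=> x y; rewrite /root_completion_edge orbC edge_sym eq_sym.
Qed.

Lemma root_completion_irrefl : irreflexive root_completion_edge.
Proof.
by move=> x; rewrite /root_completion_edge edge_irrefl eqxx; case: ifP.
Qed.

Definition root_completion : sgraph :=
  SGraph root_completion_sym root_completion_irrefl.

Definition kempe_path (u v : H) : seq root_completion :=
  if edge u v then [:: (u, false); (v, true); (u, true); (v, false)]
  else [:: (u, false); (v, false)].

Lemma kempe_pathP u v :
  u != v -> is_path ((u, false) : root_completion) (v, false) (kempe_path u v).
Proof.
move=> ne_uv; have ne_vu : v != u by rewrite eq_sym.
rewrite /is_path /kempe_path; case: ifP => uv; eexists; split; try reflexivity.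
- by rewrite /= /root_completion_edge /= uv edge_sym uv.
- by rewrite /= !inE !xpair_eqE /= ?andbT ?andbF (negPf ne_uv) (negPf ne_vu).
- by rewrite /= /root_completion_edge /= uv ne_uv.
- by rewrite /= !inE !xpair_eqE /= (negPf ne_uv).
Qed.

(** The first component acts as a colour: if [x] lies on several paths, then [x.1] is a common end
    of their edges, which is condition (2) of a scheme. *)
Lemma kempe_path_color u v x : x \in kempe_path u v -> x.1 \in [set u; v].
Proof.
by rewrite /kempe_path !inE; case: ifP => _; rewrite !inE;
  do ?[case/orP]; move/eqP->; rewrite eqxx ?orbT.
Qed.

Lemma kempe_path_root u v w :
  ((w, false) \in kempe_path u v) = (w \in [set u; v]).
Proof.
by rewrite /kempe_path !inE; case: ifP => _;
  rewrite !inE !xpair_eqE /= ?andbT ?andbF ?orbF.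
Qed.

Section Minor.
Variable C : H -> subgraph root_completion.
Hypothesis C_conn : forall v, connected (C v).
Hypothesis C_disj :
  forall u v, u != v -> [disjoint sub_vertex (C u) & sub_vertex (C v)].
Hypothesis C_root : forall v, (v, false) \in sub_vertex (C v).
Hypothesis C_edge : forall u v, edge u v -> exists x y : root_completion,
  [/\ x \in sub_vertex (C u), y \in sub_vertex (C v) & edge x y].

Let W v : {set H} := [set w | (w, true) \in sub_vertex (C v)].

Lemma bag_inj x u v :
  x \in sub_vertex (C u) -> x \in sub_vertex (C v) -> u = v.
Proof.
move=> xu xv; apply/eqP/negPn/negP => /C_disj /pred0P /(_ x) /=.
by rewrite xu xv.
Qed.

Lemma bag_root u v : (u, false) \in sub_vertex (C v) -> u = v.
Proof. exact: bag_inj. Qed.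

Lemma bag_neighbour v : W v != set0 -> exists2 w, w \in W v & edge v w.
Proof.
case/set0Pn=> w0; rewrite inE => w0v.
(* The first edge of a path in the bag from the root to w0_2 leads to the desired vertex, since the
   bag contains no other root. *)
have [_ /(_ _ _ (C_root v) w0v) /connectP[[|[w b] p] //= /andP[vw _] _]] :=
  C_conn v.
have wv : (w, b) \in sub_vertex (C v).
  by move: (vw); rewrite sub_edge_sym => /sub_edge_vertex.
exists w; move: wv (sub_edge_edge vw); rewrite /= /root_completion_edge /=;
  case: b {vw} => //; rewrite ?inE //.
- by move/bag_root->; rewrite eqxx.
- by move/bag_root->; rewrite eqxx.
Qed.

(** An edge between the two bags cannot join their roots, because the completion joins roots of
    nonadjacent vertices only. *)
Lemma bag_adjacent u v : edge u v ->
  [\/ exists2 w, w \in W u & edge w v,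
      exists2 w, w \in W v & edge u w
    | exists w w', [/\ w \in W u, w' \in W v & edge w w']].
Proof.
move=> uv; have [[w b] [[w' b'] [wu wv]]] := C_edge uv.
rewrite /= /root_completion_edge /=; case: b wu => wu; case: b' wv => wv /= ww'.
- by apply: Or33; exists w, w'; rewrite !inE.
- by apply: Or31; exists w; rewrite ?inE // -(bag_root wv).
- by apply: Or32; exists w'; rewrite ?inE // -(bag_root wu).
- by move: ww'; rewrite (bag_root wu) (bag_root wv) uv andbF.
Qed.

Hypothesis triangle_free : forall x y z : H,
  edge x y -> edge y z -> edge z x -> False.

(** The bag of [u] needs one second-copy vertex to reach v_1 and one to leave u_1; if they
    coincided, H would have a triangle. *)
Lemma bag_empty_neighbour u v : W v = set0 -> edge u v -> 1 < #|W u|.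
Proof.
move=> Wv uv; have [] := bag_adjacent uv.
- case=> w wu wv; have /bag_neighbour[w' w'u uw'] : W u != set0.
    by apply/set0Pn; exists w.
  apply/card_gt1P; exists w, w'; split=> //; apply: contraTneq uw' => <-.
  by apply/negP => uw; apply: (triangle_free uw wv); rewrite edge_sym.
- by case=> w; rewrite Wv inE.
- by case=> w [w' []]; rewrite Wv in_set0.
Qed.

Lemma sum_bags : \sum_v #|W v| <= #|H|.
Proof.
rewrite -(sum1_card (mem H)) (eq_bigr _ (fun v _ => esym (sum1_card _))).
rewrite (exchange_big_dep predT) //=; apply: leq_sum => w _.
case: (pickP (fun v => w \in W v)) => [v wv|W0]; last by rewrite big_pred0.
rewrite (big_pred1 v) // => u; apply/idP/eqP => [|-> //].
by move: wv; rewrite !inE => wv wu; apply: bag_inj wu wv.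
Qed.

Hypothesis expansion : forall S : {set H}, S != set0 ->
    {in S &, forall x y, ~~ edge x y} ->
  #|S| < #|[set y | [exists x in S, edge x y]]|.

Lemma bag_nonempty v : W v != set0.
Proof.
pose S := [set u | W u == set0]; pose N := [set y | [exists x in S, edge x y]].
have S_indep : {in S &, forall x y, ~~ edge x y}.
  move=> x y; rewrite !inE => /eqP Wx /eqP Wy; apply/negP => /bag_adjacent[].
  - by case=> w; rewrite Wx inE.
  - by case=> w; rewrite Wy inE.
  - by case=> w [w' []]; rewrite Wx in_set0.
(* Summed over [u], this gives |H| - |S| + |N| <= |H|, against expansion. *)
have leW u : (u \in ~: S) + (u \in N) <= #|W u|.
  case uN: (u \in N).
    move: uN; rewrite inE => /exists_inP[x]; rewrite inE => /eqP Wx xu.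
    apply: leq_trans (bag_empty_neighbour Wx _); last by rewrite edge_sym.
    by case: (_ \in _).
  by rewrite addn0 !inE; case: (set_0Vmem (W u)) => [->|[w wu]];
    rewrite ?eqxx // (cardD1 w) wu; case: (_ == _).
have sum_mem (A : {set H}) : \sum_u (u \in A) = #|A|.
  by rewrite -sum1_card [RHS]big_mkcond; apply: eq_bigr => u _; case: (u \in A).
have := leq_trans (leq_sum _ (fun u _ => leW u)) sum_bags.
rewrite big_split /= !sum_mem -(cardsC S) addnC leq_add2r => leNS.
apply/negP=> Wv0; suff /expansion/(_ S_indep) : S != set0.
  by rewrite ltnNge leNS.
by apply/set0Pn; exists v; rewrite inE.
Qed.

Lemma bag_endomorphism : exists s : H -> H,
  [/\ injective s, forall v, edge v (s v)
    & forall u v, edge u v -> edge (s u) (s v)].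
Proof.
have W1 v : #|W v| = 1.
  have geW u : 1 <= #|W u| by rewrite card_gt0 bag_nonempty.
  apply/eqP; rewrite eqn_leq geW andbT leqNgt; apply/negP => ltWv.
  have := sum_bags; rewrite -sum1_card leqNgt => /negP; apply.
  rewrite (bigD1 v) // [X in _ < X](bigD1 v) //= -addSn leq_add //.
  exact: leq_sum.
have /fin_all_exists[s Ws] v : exists w, W v = [set w].
  by apply/cards1P; rewrite W1.
have s_edge v : edge v (s v).
  by have [w] := bag_neighbour (bag_nonempty v); rewrite Ws inE => /eqP->.
exists s; split=> // [u v eq_s|u v uv].
  have: s u \in W u by rewrite Ws set11.
  have: s u \in W v by rewrite Ws eq_s set11.
  by rewrite !inE => sv su; apply: bag_inj su sv.
have [] := bag_adjacent uv.
- case=> w; rewrite Ws inE => /eqP-> sv.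
  by case: (triangle_free (s_edge u) sv); rewrite edge_sym.
- case=> w; rewrite Ws inE => /eqP-> su.
  by case: (triangle_free (s_edge v) _ uv); rewrite edge_sym.
- by case=> w [w' []]; rewrite !Ws !inE => /eqP-> /eqP->.
Qed.

End Minor.
End RootCompletion.

(** * The 7-cycle with the chord 03 has no such endomorphism *)

Definition chorded_cycle_edge : rel 'I_7 := fun x y =>
  [|| y == ordS x, x == ordS y, (x == 0 :> nat) && (y == 3 :> nat)
    | (x == 3 :> nat) && (y == 0 :> nat)].

Lemma chorded_cycle_sym : symmetric chorded_cycle_edge.
Proof.
move=> x y; rewrite /chorded_cycle_edge orbCA; do 2 congr (_ || _).
by rewrite orbC; congr (_ || _); rewrite andbC.
Qed.

Lemma chorded_cycle_irrefl : irreflexive chorded_cycle_edge.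
Proof. by case=> [[|[|[|[|[|[|[|//]]]]]]]] i. Qed.

Definition chorded_cycle : sgraph :=
  SGraph chorded_cycle_sym chorded_cycle_irrefl.

Lemma chorded_cycle_triangle_free (x y z : chorded_cycle) :
  edge x y -> edge y z -> edge z x -> False.
Proof.
by case: x => [[|[|[|[|[|[|[|//]]]]]]]] i;
  case: y => [[|[|[|[|[|[|[|//]]]]]]]] j //;
  case: z => [[|[|[|[|[|[|[|//]]]]]]]] k.
Qed.

Lemma chorded_cycle_expansion (S : {set chorded_cycle}) :
    S != set0 -> {in S &, forall x y, ~~ edge x y} ->
  #|S| < #|[set y | [exists x in S, edge x y]]|.
Proof.
case/set0Pn=> x xS S_indep; rewrite ltnNge; set N := [set y | _].
apply/negP => leNS.
(* If S does not expand, both of its rotations by one step fill N, so S is invariant under rotation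
   by two steps. *)
have NS_eq (f : 'I_7 -> 'I_7) : injective f ->
    (forall y, chorded_cycle_edge y (f y)) -> f @: S = N.
  move=> f_inj f_edge; apply/eqP; rewrite eqEcard card_imset // leNS andbT.
  apply/subsetP => _ /imsetP[y yS ->]; rewrite inE.
  by apply/exists_inP; exists y => //; apply: f_edge.
have SN : (@ordS 7) @: S = N.
  apply: NS_eq (can_inj (@ordSK 7)) _ => y.
  by rewrite /chorded_cycle_edge eqxx.
have PN : (@ord_pred 7) @: S = N.
  apply: NS_eq (can_inj (@ord_predK 7)) _ => y.
  by rewrite /chorded_cycle_edge ord_predK eqxx orbT.
have S2 y : y \in S -> ordS (ordS y) \in S.
  move=> yS; have: ordS y \in N by rewrite -SN imset_f.
  by rewrite -PN => /imsetP[z zS ->]; rewrite ord_predK.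
(* Four steps of length 2 around the 7-cycle make one step of length 1. *)
have: ordS x \in S.
  have ->: ordS x = iter 8 (@ordS 7) x.
    by apply: val_inj; case: (x) => [[|[|[|[|[|[|[|//]]]]]]]] i.
  by do 4!apply: (S2); apply: xS.
by move/(S_indep _ _ xS); rewrite /= /chorded_cycle_edge eqxx.
Qed.

Lemma chorded_cycle_endomorphism (s : chorded_cycle -> chorded_cycle) :
    injective s -> (forall v, edge v (s v)) ->
  (forall u v, edge u v -> edge (s u) (s v)) -> False.
Proof.
move=> s_inj s_nbr s_edge.
pose i k (lt_k : k < 7) : chorded_cycle := Ordinal lt_k.
pose v0 := i 0 isT; pose v1 := i 1 isT; pose v2 := i 2 isT.
pose v3 := i 3 isT; pose v4 := i 4 isT; pose v6 := i 6 isT.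
have ne (u v : chorded_cycle) : u != v -> s u != s v by rewrite (inj_eq s_inj).
have := s_edge v0 v1 isT; have := s_edge v0 v3 isT; have := s_edge v0 v6 isT.
have := s_edge v3 v4 isT; have := s_edge v3 v2 isT.
(* Distinct images of the three neighbours of 0, and likewise of 3, force 0 and 3 to go to vertices
   of degree 3. *)
have := ne v1 v3 isT; have := ne v1 v6 isT; have := ne v3 v6 isT.
have := ne v0 v4 isT; have := ne v0 v2 isT; have := ne v2 v4 isT.
have := s_nbr v0; have := s_nbr v1; have := s_nbr v2.
have := s_nbr v3; have := s_nbr v4; have := s_nbr v6.
case: (s v0) => [[|[|[|[|[|[|[|//]]]]]]]] ?;
case: (s v3) => [[|[|[|[|[|[|[|//]]]]]]]] ? //;
case: (s v1) => [[|[|[|[|[|[|[|//]]]]]]]] ? //;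
case: (s v6) => [[|[|[|[|[|[|[|//]]]]]]]] ? //;
case: (s v4) => [[|[|[|[|[|[|[|//]]]]]]]] ? //;
case: (s v2) => [[|[|[|[|[|[|[|//]]]]]]]] ? //.
Qed.

Lemma not_contractible_complete7 : ~ contractible (complete 7).
Proof.
pose H := chorded_cycle; pose G := root_completion H.
pose r (v : complete 7) : G := (v, false).
have r_inj : injective r by move=> u v [].
(* An edge is an unordered pair, so [pick] chooses the end from which its path is listed. *)
pose P (e : {set complete 7}) : seq G :=
  if [pick p : H * H | (p.1 != p.2) && (e == [set p.1; p.2])] is Some p
  then kempe_path p.1 p.2 else [::].
have PE e : e \in edges (complete 7) -> exists u v : H,
    [/\ u != v, e = [set u; v] & P e = kempe_path u v].
  case/imsetP=> p; rewrite inE => ne_p eq_e; rewrite /P.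
  case: pickP => [[u v] /= /andP[ne_uv /eqP->]|/(_ p)]; first by exists u, v.
  by rewrite eq_e eqxx andbT (ne_p : p.1 != p.2).
have P_scheme : is_scheme r P.
  split=> [e /PE[u [v [ne_uv -> ->]]]|F F0 FE [x xF]].
    exists u, v; split=> //; first exact: kempe_pathP.
    apply/setP=> x; rewrite !inE; apply/andP/orP => [[xP /imsetP[w _ xw]]|xr].
      by move: xP; rewrite xw kempe_path_root !inE => /orP[] /eqP->;
        [left | right].
    have [w wuv ->] : exists2 w, w \in [set u; v] & x = r w.
      by case: xr => /eqP->; [exists u | exists v]; rewrite ?set21 ?set22.
    by rewrite kempe_path_root; split; last exact: imset_f.
  exists x.1 => e eF; have [u [v [_ eq_e Pe]]] := PE e (subsetP FE e eF).
  by have := xF e eF; rewrite Pe eq_e; apply: kempe_path_color.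
move=> /(_ G r r_inj (ex_intro _ P P_scheme))[C [C_conn C_disj C_root C_edge]].
have C_edgeH (u v : H) : edge u v -> exists x y : G,
    [/\ x \in sub_vertex (C u), y \in sub_vertex (C v) & edge x y].
  move=> uv; apply: C_edge; apply: contraTneq uv => ->.
  by rewrite edge_irrefl.
have [s [s_inj s_nbr s_edge]] := @bag_endomorphism H C C_conn C_disj C_root
  C_edgeH chorded_cycle_triangle_free chorded_cycle_expansion.
exact: chorded_cycle_endomorphism s_inj s_nbr s_edge.
Qed.

Theorem corollary7p12 :
  Mprime_contractible (complete 7) /\ ~ contractible (complete 7).
Proof.
split; first exact: Mprime_contractible_complete.
exact: not_contractible_complete7.
Qed.
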